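(* For every integer $d \geq 4$ there exists a reflexive polytope $P \subset \mathbb{R}^d$ of dimension $d$ which is very ample but not normal.
   Context: A lattice polytope is a convex polytope $P \subset \mathbb{R}^d$ each of whose vertices belongs to $\mathbb{Z}^d$. A lattice polytope $P \subset \mathbb{R}^d$ of dimension $d$ is reflexive if the origin of $\mathbb{R}^d$ belongs to the interior of $P$ and the dual polytope $P^\vee = \{\mathbf{x} \in \mathbb{R}^d : \langle \mathbf{x}, \mathbf{y}\rangle \leq 1 \text{ for all } \mathbf{y} \in P\}$ is a lattice polytope, where $\langle\cdot,\cdot\rangle$ is the canonical inner product. For an integer $N \geq 1$ put $NP = \{N\mathbf{a} : \mathbf{a} \in P\}$. A lattice polytope $P \subset \mathbb{R}^d$ is normal if for each integer $N \geq 1$ and each $\mathbf{a} \in NP \cap \mathbb{Z}^d$ there exist $\mathbf{a}_1, \ldots, \mathbf{a}_N \in P \cap \mathbb{Z}^d$ with $\mathbf{a} = \mathbf{a}_1 + \cdots + \mathbf{a}_N$. It is very ample if the same holds for all sufficiently large $N$, i.e. there is $N_0$ such that for each $N \geq N_0$ and each $\mathbf{a} \in NP \cap \mathbb{Z}^d$ there exist $\mathbf{a}_1, \ldots, \mathbf{a}_N \in P \cap \mathbb{Z}^d$ with $\mathbf{a} = \mathbf{a}_1 + \cdots + \mathbf{a}_N$. *)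

(* Defs.v *)
From HB Require Import structures.
From mathcomp Require Import all_boot all_order all_algebra.
From mathcomp Require Import all_classical all_reals all_analysis.
Import Order.TTheory GRing.Theory Num.Theory numFieldNormedType.Exports.

Set Implicit Arguments.
Unset Strict Implicit.
Unset Printing Implicit Defensive.

Local Open Scope classical_set_scope.
Local Open Scope ring_scope.

(* Row vectors 'rV[R]_d over a realType R model the Euclidean space R^d. *)
Section Polytopes.
Context {R : realType} {d : nat}.
Implicit Types (A P : set 'rV[R]_d) (x y : 'rV[R]_d).

Definition inner x y : R := \sum_(i < d) x 0 i * y 0 i.

Definition lattice : set 'rV[R]_d := [set x | x \is a mxOver Num.int].

Definition affine_hull A : set 'rV[R]_d :=
  [set x | exists n (p : 'I_n -> 'rV[R]_d) (a : 'I_n -> R),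
    [/\ forall i, A (p i), \sum_(i < n) a i = 1
      & x = \sum_(i < n) a i *: p i]].

Definition convex_hull A : set 'rV[R]_d :=
  [set x | exists n (p : 'I_n -> 'rV[R]_d) (a : 'I_n -> R),
    [/\ forall i, A (p i), forall i, 0 <= a i, \sum_(i < n) a i = 1
      & x = \sum_(i < n) a i *: p i]].

Definition convex_polytope P : Prop :=
  exists2 A : set 'rV[R]_d, finite_set A & P = convex_hull A.

(* The dimension of A is that of the linear space U directing its affine hull;
   the empty set has no dimension in this sense. *)
Definition has_dimension A (k : nat) : Prop :=
  exists x0 (U : {vspace 'rV[R]_d}),
    affine_hull A = [set x | x - x0 \in U] /\ \dim U = k.

(* A vertex is a 0-dimensional face: {x} is the intersection of P with a
   hyperplane <c, y> = b such that <c, y> <= b is valid on P. *)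
Definition vertex P x : Prop :=
  exists (c : 'rV[R]_d) (b : R),
    (forall y, P y -> inner c y <= b) /\
    P `&` [set y | inner c y = b] = [set x].

Definition lattice_polytope P : Prop :=
  convex_polytope P /\ forall x, vertex P x -> lattice x.

Definition dual_polytope P : set 'rV[R]_d :=
  [set x | forall y, P y -> inner x y <= 1].

Definition reflexive_polytope P : Prop :=
  [/\ lattice_polytope P, has_dimension P d, interior P 0
    & lattice_polytope (dual_polytope P)].

Definition dilate (N : nat) P : set 'rV[R]_d := [set N%:R *: a | a in P].

Definition integer_decomposition P (N : nat) : Prop :=
  forall a, (dilate N P `&` lattice) a ->
    exists2 b : 'I_N -> 'rV[R]_d,
      (forall i, (P `&` lattice) (b i)) & a = \sum_(i < N) b i.

Definition normal_polytope P : Prop :=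
  lattice_polytope P /\ forall N, (1 <= N)%N -> integer_decomposition P N.

Definition very_ample P : Prop :=
  lattice_polytope P /\
  exists N0, forall N, (1 <= N)%N -> (N0 <= N)%N -> integer_decomposition P N.

End Polytopes.

(* Main.v *)
(* Let E4 be the lattice polytope in R^3 fibred over the unit square (x, y), with
   heights t in [0, 1] over (0, 0), (1, 0), (0, 1) and in [4, 5] over (1, 1).
   The two diagonals of the square yield heights 0..2 and 4..6 over (1, 1) in
   2 E4, so that (1, 1, 3) is a lattice point of 2 E4 which is not a sum of two
   lattice points of E4; it is the only hole.  In R^4, with last coordinate z,
   let P4 be the pyramid over E4 x {z = 1} whose apex v = (-1, -1, -3, -2) is
   the opposite of the hole.  All facets of P4 are at lattice distance one from
   the origin, and the lattice points of P4 are its vertices, (0, 0, 1, 0),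
   (0, 0, -1, 0) and 0; those on each facet through v, together with 0, generate
   all lattice points of the cone over it.  The hole stays a hole in 2 P4 since
   E4 x {z = 1} is a facet, but in degree 3 it is the sum of (1, 0, 1, 1),
   (0, 1, 1, 1) and (0, 0, 1, 0).  Multiplying by intervals [-1, 1] reaches
   every higher dimension.
   The dual polytope is the convex hull of the facet normals by Farkas' lemma. *)
Require Import Defs.
From mathcomp Require Import all_boot all_order all_algebra.
From mathcomp Require Import all_classical all_reals all_analysis.
From mathcomp Require Import zify ring lra.
Import Order.TTheory GRing.Theory Num.Theory numFieldNormedType.Exports.

Set Implicit Arguments.
Unset Strict Implicit.
Unset Printing Implicit Defensive.

Local Open Scope classical_set_scope.
Local Open Scope ring_scope.

(** * Farkas' lemma, convex hulls and polytopes cut out by half-spaces *)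

Section Inner.
Context {R : realType}.

Lemma innerC d (x y : 'rV[R]_d) : inner x y = inner y x.
Proof. by apply: eq_bigr => i _; rewrite mulrC. Qed.

Lemma innerDr d (x y z : 'rV[R]_d) : inner x (y + z) = inner x y + inner x z.
Proof. by rewrite /inner -big_split; apply: eq_bigr => i _; rewrite mxE mulrDr. Qed.

Lemma innerZr d k (x y : 'rV[R]_d) : inner x (k *: y) = k * inner x y.
Proof. by rewrite /inner mulr_sumr; apply: eq_bigr => i _; rewrite mxE mulrCA. Qed.

Lemma inner0r d (x : 'rV[R]_d) : inner x 0 = 0.
Proof. by rewrite -(scale0r 0) innerZr mul0r. Qed.

Lemma innerDl d (x y z : 'rV[R]_d) : inner (x + y) z = inner x z + inner y z.
Proof. by rewrite innerC innerDr !(innerC z). Qed.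

Lemma innerZl d k (x y : 'rV[R]_d) : inner (k *: x) y = k * inner x y.
Proof. by rewrite innerC innerZr innerC. Qed.

Lemma inner_sumr d I (r : seq I) (x : 'rV[R]_d) (F : I -> 'rV[R]_d) :
  inner x (\sum_(i <- r) F i) = \sum_(i <- r) inner x (F i).
Proof. by elim/big_rec2: _ => [|i a b _ <-]; rewrite ?inner0r ?innerDr. Qed.

Lemma inner_row_mx m d (s s' : 'rV[R]_m) (x x' : 'rV[R]_d) :
  inner (row_mx s x) (row_mx s' x') = inner s s' + inner x x'.
Proof.
by rewrite /inner big_split_ord; congr (_ + _); apply: eq_bigr => i _;
  rewrite ?row_mxEl ?row_mxEr.
Qed.

Lemma inner_rV1 (s s' : 'rV[R]_1) : inner s s' = s 0 0 * s' 0 0.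
Proof. by rewrite /inner big_ord1. Qed.

(* If [y] separates [x] from all generators but [b], project along [b] onto
   the hyperplane orthogonal to [y] and recurse with one generator less. *)
Lemma farkas n (B : seq 'rV[R]_n) (x : 'rV[R]_n) :
  (exists2 c : nat -> R, forall i, 0 <= c i
      & x = \sum_(i < size B) c i *: B`_i) \/
  (exists2 y : 'rV[R]_n, forall b, b \in B -> 0 <= inner y b & inner y x < 0).
Proof.
move: {2}(size B) (erefl (size B)) => m; elim: m => [|m IH] in B x *.
  move/size0nil=> ->; have [->|x0] := eqVneq x 0.
    by left; exists (fun=> 0); rewrite ?big_ord0.
  right; exists (-1 *: x) => //; rewrite innerZl mulN1r oppr_lt0.
  rewrite lt0r sumr_ge0 ?andbT; last by move=> i _; rewrite -expr2 sqr_ge0.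
  apply: contra_neq x0 => /eqP; rewrite psumr_eq0.
    move=> /allP h; apply/rowP => i; rewrite mxE; apply/eqP.
    by have := h i (mem_index_enum _); rewrite -expr2 sqrf_eq0.
  by move=> i _; rewrite -expr2 sqr_ge0.
case: B => // b B [sB].
case: (IH B x sB) => [[c c0 ->]|[y yB yx]].
  left; exists (fun i => if i is j.+1 then c j else 0); first by case.
  by rewrite /= big_ord_recl scale0r add0r.
have [yb|yb] := leP 0 (inner y b).
  by right; exists y => // b'; rewrite inE => /predU1P[->//|/yB].
pose q v := v + (- (inner y v / inner y b)) *: b.
case: (IH (map q B) (q x)); rewrite ?size_map //.
  move=> [c c0 qx]; left.
  (* Undoing [q] gives this coefficient of [b], a quotient of two negative numbers. *)
  exists (fun i => if i is j.+1 then c j else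
    (inner y x - \sum_(i < size B) c i * inner y B`_i) / inner y b).
    case=> [|j]; last exact: c0.
    rewrite -mulrNN -invrN mulr_ge0 ?invr_ge0 ?oppr_ge0 ?(ltW yb)//.
    rewrite subr_le0 (le_trans (ltW yx))// sumr_ge0// => i _.
    by rewrite mulr_ge0// yB// mem_nth.
  rewrite /= big_ord_recl/=.
  transitivity (q x + (inner y x / inner y b) *: b).
    by rewrite /q -addrA -scalerDl addNr scale0r addr0.
  rewrite qx mulrBl scalerBl [RHS]addrC [RHS]addrA [RHS]addrAC; congr (_ + _).
  rewrite mulr_suml scaler_suml -sumrB; apply: eq_bigr => i _.
  by rewrite (nth_map 0)// /q scalerDr scaleNr scalerN scalerA mulrA.
move=> [w wB wx]; right.
(* The new functional is [w] composed with [q], which kills [b]. *)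
have wE v : inner (w + (- (inner w b / inner y b)) *: y) v = inner w (q v).
  rewrite /q innerDl innerDr innerZl innerZr; field.
  by rewrite lt_eqF.
exists (w + (- (inner w b / inner y b)) *: y); last by rewrite wE.
move=> b'; rewrite wE inE => /predU1P[->|b'B].
  by rewrite /q divff ?lt_eqF// scaleN1r subrr inner0r.
by apply: wB; rewrite map_f.
Qed.

(** Homogenize: at height 1 convex combinations become conic ones, and the first coordinate makes
    the weights sum to 1. A separating functional from [farkas] splits into a normal and a bound. *)
Lemma convex_hullP d (A : seq 'rV[R]_d) (x : 'rV[R]_d) :
  convex_hull [set` A] x <->
  forall y c, (forall a, a \in A -> inner y a <= c) -> inner y x <= c.
Proof.
split=> [[n [p [a [Ap a0 a1 ->]]]] y c yA|xA].
  rewrite inner_sumr -[c]mul1r -a1 mulr_suml; apply: ler_sum => i _.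
  by rewrite innerZr ler_wpM2l// yA// Ap.
pose hat v : 'rV[R]_(1 + d) := row_mx 1 v.
have [[c c0 xE]|[y yA yx]] := farkas (map hat A) (hat x).
  exists (size A), (nth 0 A), c; rewrite size_map in xE.
  have {}xE : hat x = \sum_(i < size A) c i *: hat A`_i.
    by rewrite xE; apply: eq_bigr => i _; rewrite (nth_map 0).
  split=> //; first by move=> i; rewrite /= mem_nth.
    transitivity (lsubmx (hat x) 0 0); last by rewrite /hat row_mxKl mxE.
    rewrite xE raddf_sum summxE; apply: eq_bigr => i _ /=.
    by rewrite linearZ /= /hat row_mxKl !mxE mulr1.
  rewrite -{1}[x](row_mxKr 1) -/(hat x) xE raddf_sum; apply: eq_bigr => i _ /=.
  by rewrite linearZ /= /hat row_mxKr.
have yE v : inner y (hat v) = y 0 0 + inner (rsubmx y) v.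
  by rewrite -{1}[y]hsubmxK inner_row_mx inner_rV1 !mxE mulr1 lshift0.
have := xA (-1 *: rsubmx y) (y 0 0); rewrite innerZl => /(_ _)/wrap[] => [a aA|].
  by have := yA _ (map_f hat aA); rewrite yE innerZl; lra.
by move: yx; rewrite yE; lra.
Qed.

(* A point [y] with [<y, b> <= c] for all [b] in [B] rescales to a point of
   the polytope [P] cut out by [B]; this reads off the support functional of
   the dual of [P]. *)
Lemma dual_polytopeE d (P : set 'rV[R]_d) (B : seq 'rV[R]_d) :
  P = [set x | forall b, b \in B -> inner b x <= 1] ->
  convex_hull [set` B] 0 -> dual_polytope P = convex_hull [set` B].
Proof.
move=> PE /convex_hullP B0; apply/seteqP; split=> x /=; last first.
  move=> /convex_hullP xB y; rewrite PE => yB; rewrite innerC; apply: xB => b bB.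
  by rewrite innerC; apply: yB.
move=> xP; apply/convex_hullP => y c yB.
have := B0 y c yB; rewrite inner0r le_eqVlt => /predU1P[c0|c0].
  (* Here [y] spans a ray inside [P]; if it paired positively with [x], some multiple would pair to
     2. *)
  rewrite leNgt -c0; apply/negP => yx.
  have : inner x ((2 / inner y x) *: y) <= 1.
    apply: xP; rewrite PE => b bB; rewrite innerZr (innerC b).
    apply: le_trans ler01; apply: mulr_ge0_le0; last by rewrite [leRHS]c0 yB.
    by apply: divr_ge0; [exact: ler0n|exact: ltW].
  by rewrite innerZr (innerC x) divfK ?gt_eqF//; lra.
have : inner x (c^-1 *: y) <= 1.
  apply: xP; rewrite PE => b bB; rewrite innerZr innerC mulrC.
  by rewrite ler_pdivrMr// mul1r yB.
by rewrite innerZr innerC mulrC ler_pdivrMr// mul1r.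
Qed.

(** A point of positive weight in a combination equal to [x] must also attain the maximum [b], hence
    equals [x]. *)
Lemma convex_hull_vertex d (A : set 'rV[R]_d) (x : 'rV[R]_d) :
  vertex (convex_hull A) x -> A x.
Proof.
move=> [c [b [cP /seteqP[xE xP]]]].
have [[n [p [a [Ap a0 a1 xp]]]] cx] := xP x erefl.
have AP i : inner c (p i) <= b.
  apply: cP; exists 1%N, (fun=> p i), (fun=> 1).
  by split=> //; rewrite big_ord1 ?scale1r.
have [i ai0] : exists i, 0 < a i.
  apply/existsP; apply: contra_eqT a1 => /existsPn a_le0.
  rewrite big1 1?eq_sym ?oner_eq0// => i _.
  by apply/eqP; rewrite eq_le a0 leNgt a_le0.
suff pi_x : p i = x by rewrite -pi_x.
apply: xE; split; first by exists 1%N, (fun=> p i), (fun=> 1);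
  split=> //; rewrite big_ord1 ?scale1r.
apply/eqP; rewrite eq_le AP leNgt; apply/negP => pib.
have: inner c x < b.
  rewrite xp inner_sumr -[b]mul1r -a1 mulr_suml (bigD1 i)//= [ltRHS](bigD1 i)//=.
  rewrite innerZr ltr_leD ?ltr_pM2l//; apply: ler_sum => j _.
  by rewrite innerZr ler_wpM2l.
by rewrite cx ltxx.
Qed.

Lemma lattice_polytope_hull d (A : seq 'rV[R]_d) :
  (forall a, a \in A -> lattice a) -> lattice_polytope (convex_hull [set` A]).
Proof.
move=> AL; split; first by exists [set` A] => //; exact: finite_seq.
by move=> x /convex_hull_vertex/AL.
Qed.

Lemma nbhs0_halfspaces d (B : seq 'rV[R]_d) :
  interior [set x | forall b, b \in B -> inner b x <= 1] 0.
Proof.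
(* [M] exceeds the l1 norm of every [b], so the sup-norm ball of radius 1 / M satisfies all
   inequalities. *)
pose M : R := 1 + \sum_(b <- B) \sum_(i < d) `|b 0 i|.
have M0 : 0 < M.
  by rewrite ltr_pwDl// sumr_ge0// => b _; rewrite sumr_ge0.
apply/nbhs_ballP; exists M^-1 => /=; first by rewrite invr_gt0.
move=> x xM b bB; have {}xM i : `|x 0 i| <= M^-1.
  by case: xM => _ /(_ 0 i); rewrite /ball /= mxE sub0r normrN => /ltW.
apply: (@le_trans _ _ (\sum_(i < d) `|b 0 i| * M^-1)).
  apply: ler_sum => i _; rewrite (le_trans (ler_norm _))// normrM.
  by rewrite ler_wpM2l.
rewrite -mulr_suml ler_pdivrMr// mul1r /M (big_rem b)//= addrCA lerDl.
by rewrite addr_ge0// sumr_ge0// => ? _; rewrite sumr_ge0.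
Qed.

Lemma has_dimension_halfspaces d (B : seq 'rV[R]_d) :
  has_dimension [set x | forall b, b \in B -> inner b x <= 1] d.
Proof.
exists 0, fullv; split; last by rewrite dimvf /dim /= mul1n.
apply/seteqP; split=> x _ /=; first by rewrite memvf.
(* x / M and 0 lie in the set, and their affine combination with weights M and 1 - M is x. *)
pose M : R := 1 + \sum_(b <- B) `|inner b x|.
have M0 : 0 < M by rewrite ltr_pwDl// sumr_ge0.
exists 2, (fun i => if i == ord0 then M^-1 *: x else 0),
  (fun i => if i == ord0 then M else 1 - M).
split; [|by rewrite !big_ord_recl big_ord0 /= addr0 addrC subrK|].
  move=> i; case: ifP => _ b bB /=; last by rewrite inner0r.
  rewrite innerZr mulrC ler_pdivrMr// mul1r /M (big_rem b)//= addrCA.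
  by rewrite (le_trans (ler_norm _))// lerDl addr_ge0// sumr_ge0.
by rewrite !big_ord_recl big_ord0 /= scaler0 !addr0 scalerA divff ?gt_eqF// scale1r.
Qed.


End Inner.

(** * Points of the dilates of P4 as weighted sums of its lattice points *)

Section Cover.
Context {D : realDomainType}.
Implicit Types x y t z n k j i : D.

(** The inequalities of [facets4] for the n-th dilate, in the same order, over any ordered domain so
    that one argument serves real and integer points. *)
Definition facet_ineqs n x y t z : Prop :=
  [/\ [/\ z <= n, z - 3 * x <= n, z - 3 * y <= n & 3 * x - 2 * z <= n],
      [/\ 3 * y - 2 * z <= n, z - t <= n & 4 * x + 4 * y - t - 3 * z <= n],
      t - 4 * x <= n & t - 4 * y <= n].

(* [(x, y, t, z)] is the combination of the twelve lattice points of [P4],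
   in the order of [points4], with the given weights of total [n]. *)
Definition weighted_sum n x y t z : Prop :=
  exists b0 t0 b1 t1 b2 t2 b3 t3 v e f o : D,
  [/\ [/\ 0 <= b0, 0 <= t0, 0 <= b1 & 0 <= t1],
      [/\ 0 <= b2, 0 <= t2, 0 <= b3 & 0 <= t3],
      [/\ 0 <= v, 0 <= e, 0 <= f & 0 <= o],
      n = b0 + t0 + b1 + t1 + b2 + t2 + b3 + t3 + v + e + f + o &
      [/\ x = b1 + t1 + b3 + t3 - v, y = b2 + t2 + b3 + t3 - v,
          t = t0 + t1 + t2 + 4 * b3 + 5 * t3 - 3 * v + e - f &
          z = b0 + t0 + b1 + t1 + b2 + t2 + b3 + t3 - 2 * v]].

(** The height t runs between the lower hull max(0, 4 (x + y - z)) and the upper hull z + 4 min(x,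
    y). *)
Definition in_cone_E4 x y t z : Prop :=
  [/\ [/\ 0 <= x, x <= z, 0 <= y & y <= z],
      0 <= t, 4 * (x + y - z) <= t, t <= z + 4 * x & t <= z + 4 * y].

(* Split [x, y] with [i] copies of the vertex (1, 1) of the unit square; the
   heights of the four columns then add up to anything in [4 i, 4 i + z]. *)
Lemma cone_E4_weighted_sum n x y t z i :
  0 <= i -> x + y - z <= i -> i <= x -> i <= y -> 4 * i <= t ->
  t <= 4 * i + z -> z <= n -> weighted_sum n x y t z.
Proof.
move=> i0 ixyz ix iy it tiz zn.
have split_height (h a b : D) : 0 <= a -> 0 <= b -> 0 <= h -> h <= a + b ->
    exists c d : D, [/\ 0 <= c, c <= a, 0 <= d, d <= b & h = c + d].
  move=> a0 b0 h0 hab; have [ha|ha] := leP h a.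
    by exists h, 0; split=> //; lra.
  by exists a, (h - a); split; lra.
(* Distribute the height t - 4 i first between the two sides x = 0 and x = 1 of the square, then
   between the two columns of each side. *)
have [|||| r [s [r0 rle s0 sle hrs]]] :=
  split_height (t - 4 * i) (z - x) x; [lra..|].
have [|||| t0 [t2 [t00 t0le t20 t2le h02]]] :=
  split_height r (z - x - y + i) (y - i); [lra..|].
have [|||| t1 [t3 [t10 t1le t30 t3le h13]]] :=
  split_height s (x - i) i; [lra..|].
exists (z - x - y + i - t0), t0, (x - i - t1), t1, (y - i - t2), t2, (i - t3), t3,
  0, 0, 0, (n - z).
by split; [split; lra..|lra|split; lra].
Qed.

(* A substitute for [s = 3 k + j] with [k = s %/ 3] over the integers and
   [k = s / 3] over a field. *)
Definition has_thirds : Prop :=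
  forall s : D, 0 <= s -> exists k j : D,
    [/\ 0 <= k, 0 <= j, s = 3 * k + j & forall u, - s <= 3 * u -> - k <= u].

Lemma weighted_sum_swap n x y t z :
  weighted_sum n y x t z -> weighted_sum n x y t z.
Proof.
case=> b0 [t0 [b1 [t1 [b2 [t2 [b3 [t3 [v [e [w [u]]]]]]]]]]].
move=> [[? ? ? ?] [? ? ? ?] ? nE [xE yE tE zE]].
exists b0, t0, b2, t2, b1, t1, b3, t3, v, e, w, u.
by split=> //; [rewrite nE; ring|split; lra].
Qed.

(** The involution (x, y, t, z) -> (x, z - y, z + 4 x - t, z) permutes the twelve points: it turns
    the columns upside down, fixes v and exchanges (0, 0, 1, 0) with (0, 0, -1, 0). *)
Lemma weighted_sum_reflect n x y t z :
  weighted_sum n x (z - y) (z + 4 * x - t) z -> weighted_sum n x y t z.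
Proof.
case=> b0 [t0 [b1 [t1 [b2 [t2 [b3 [t3 [v [e [w [u]]]]]]]]]]].
move=> [[? ? ? ?] [? ? ? ?] [? ? ? ?] nE [xE yE tE zE]].
exists t2, b2, t3, b3, t0, b0, t1, b1, v, w, e, u.
by split=> //; [rewrite nE; ring|split; lra].
Qed.

(** Removing -x copies of v leads to the cone over the ridge x = 0, a unit square in (y, t) that a
    diagonal cuts into two unimodular triangles. *)
Lemma square_facet_weighted_sum n x y t z :
  x <= 0 -> x <= y -> x <= z - y -> 3 * x <= t -> t <= z + x -> z - 3 * x <= n ->
  weighted_sum n x y t z.
Proof.
move=> *; have [yt|ty] := leP (y - x) (t - 3 * x).
  exists (z + x - t), (t - 3 * x - (y - x)), 0, 0, 0, (y - x), 0, 0,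
    (- x), 0, 0, (n - (z - 3 * x)).
  by split; [split; lra..|lra|split; lra].
exists (z - x - y), 0, 0, 0, (y - x - (t - 3 * x)), (t - 3 * x), 0, 0,
  (- x), 0, 0, (n - (z - 3 * x)).
by split; [split; lra..|lra|split; lra].
Qed.

(** Write -t = 3 k + j. Removing k copies of v leaves height -j, absorbed by (0, 0, -1, 0); the rest
    lies over the triangle t = 0, since the last clause of [has_thirds] keeps x + k and y + k
    nonnegative. *)
Lemma triangle_facet_weighted_sum n x y t z : has_thirds ->
  t <= 0 -> t <= 3 * x -> t <= 3 * y -> x + y <= z -> z - t <= n ->
  weighted_sum n x y t z.
Proof.
move=> thirds t0 tx ty xyz zn.
have [|k [j [k0 j0 tkj kmin]]] := thirds (- t); first lra.
have [||kx ky] := conj (kmin x _) (kmin y _); [lra..|].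
exists (z - x - y), 0, (x + k), 0, (y + k), 0, 0, 0, k, 0, j, (n - (z - t)).
by split; [split; lra..|lra|split; lra].
Qed.

(* The cone over a facet through [v] is [v] plus the cone over the ridge
   opposite to [v]. It is found by minimizing the eight slacks of the cone over
   E4, each divided by its value at [-v], and the symmetries of E4 leave one
   quadrangular and one triangular ridge to consider. *)
Lemma facet_ineqs_cover n x y t z : has_thirds -> facet_ineqs n x y t z ->
  weighted_sum n x y t z \/ in_cone_E4 x y t z.
Proof.
move=> thirds [[? ? ? ?] [? ? ?] ? ?].
(* At -v = (1, 1, 3, 2) the slacks x, z - x, y, z - y are 1 and the other four are 3; a factor 3
   clears denominators. *)
pose s := [:: 3 * x; 3 * (z - x); 3 * y; 3 * (z - y); t; t - 4 * (x + y - z);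
  z + 4 * x - t; z + 4 * y - t].
pose i : 'I_8 := [arg min_(i < ord0) s`_i]%O.
have imin (j : 'I_8) : s`_i <= s`_j.
  by rewrite /i; case: arg_minP => //= k _; exact.
have [h0 h1 h2 h3] := And4 (imin (inord 0)) (imin (inord 1)) (imin (inord 2)) (imin (inord 3)).
have [h4 h5 h6 h7] := And4 (imin (inord 4)) (imin (inord 5)) (imin (inord 6)) (imin (inord 7)).
move: h0 h1 h2 h3 h4 h5 h6 h7; rewrite !inordK//=.
have [si0|] := leP 0 s`_i; first by right; split; [split|..]; lra.
case: i {imin} => -[|[|[|[|[|[|[|[|//]]]]]]]] _ /= *; left.
- by apply: square_facet_weighted_sum; lra.
- apply/weighted_sum_swap/weighted_sum_reflect/weighted_sum_swap.
  by apply: square_facet_weighted_sum; lra.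
- by apply/weighted_sum_swap/square_facet_weighted_sum; lra.
- by apply/weighted_sum_reflect/weighted_sum_swap/square_facet_weighted_sum; lra.
- by apply: (triangle_facet_weighted_sum thirds); lra.
- apply/weighted_sum_swap/weighted_sum_reflect.
  by apply/weighted_sum_swap/weighted_sum_reflect/(triangle_facet_weighted_sum thirds); lra.
- by apply/weighted_sum_reflect/(triangle_facet_weighted_sum thirds); lra.
- by apply/weighted_sum_swap/weighted_sum_reflect/(triangle_facet_weighted_sum thirds); lra.
Qed.

End Cover.

(** * Certificates of reflexivity and products with an interval *)

Section DualPair.
Context {R : realType}.

(** Generators and inequalities together certify reflexivity and are explicit for products; the last
    clause makes the dual the hull of [B]. *)
Definition dual_pair d (P : set 'rV[R]_d) (A B : seq 'rV[R]_d) : Prop :=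
  [/\ forall a, a \in A -> lattice a, forall b, b \in B -> lattice b,
      P = convex_hull [set` A], P = [set x | forall b, b \in B -> inner b x <= 1]
    & convex_hull [set` B] 0].

Lemma dual_pair_reflexive d (P : set 'rV[R]_d) (A B : seq 'rV[R]_d) :
  dual_pair P A B -> reflexive_polytope P.
Proof.
move=> [AL BL PA PB B0]; split.
- by rewrite PA; apply: lattice_polytope_hull.
- by rewrite PB; apply: has_dimension_halfspaces.
- by rewrite PB; apply: nbhs0_halfspaces.
- by rewrite (dual_polytopeE PB B0); apply: lattice_polytope_hull.
Qed.

Definition prod_interval d (P : set 'rV[R]_d) : set 'rV[R]_(1 + d) :=
  [set x | -1 <= lsubmx x 0 0 <= 1 /\ P (rsubmx x)].

Lemma lattice_row_mx d (s : 'rV[R]_1) (a : 'rV[R]_d) :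
  lattice (row_mx s a) <-> lattice s /\ lattice a.
Proof.
split=> [/mxOverP sa|[/mxOverP hs /mxOverP ha]].
  split; apply/mxOverP => i j.
    by have := sa i (lshift d j); rewrite row_mxEl.
  by have := sa i (rshift 1 j); rewrite row_mxEr.
by apply/mxOverP => i j; rewrite mxE; case: splitP.
Qed.

Lemma dual_pair_prod_interval d (P : set 'rV[R]_d) (A B : seq 'rV[R]_d) :
  dual_pair P A B ->
  dual_pair (prod_interval P) (map (row_mx 1) A ++ map (row_mx (-1)) A)
    (row_mx 1 0 :: row_mx (-1) 0 :: map (row_mx 0) B).
Proof.
move=> [AL BL PA PB B0].
have lat1 : lattice (1 : 'rV[R]_1).
  by apply/mxOverP => i j; rewrite mxE; case: eqP.
have latN1 : lattice (-1 : 'rV[R]_1).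
  by apply/mxOverP => i j; rewrite !mxE rpredN; exact: natr_int.
have lat0 n : lattice (0 : 'rV[R]_n) by apply/mxOverP => i j; rewrite mxE.
have BN1 (w : 'rV[R]_(1 + d)) C :
    row_mx (-1) 0 \in [:: w, row_mx (-1) 0 & C : seq 'rV[R]_(1 + d)].
  by rewrite !inE eqxx orbT.
split.
- move=> a; rewrite mem_cat => /orP[] /mapP[a' a'A ->];
    by apply/lattice_row_mx; split; [|exact: AL].
- move=> b; rewrite !inE => /or3P[/eqP->|/eqP->|/mapP[b' b'B ->]];
    by apply/lattice_row_mx; split=> //; exact: BL.
- apply/seteqP; split=> x /=.
    move=> [/andP[xl xr] xP]; apply/convex_hullP => y c yA.
    move: xP; rewrite PA => /convex_hullP xP.
    rewrite -[x]hsubmxK -[y]hsubmxK inner_row_mx inner_rV1.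
    have yA1 a : a \in A -> lsubmx y 0 0 + inner (rsubmx y) a <= c.
      move=> aA; have := yA (row_mx 1 a).
      rewrite -{1}[y]hsubmxK inner_row_mx inner_rV1 !mxE mulr1; apply.
      by rewrite mem_cat map_f.
    have yA2 a : a \in A -> - lsubmx y 0 0 + inner (rsubmx y) a <= c.
      move=> aA; have := yA (row_mx (-1) a).
      rewrite -{1}[y]hsubmxK inner_row_mx inner_rV1 !mxE mulrN1; apply.
      by rewrite mem_cat map_f ?orbT.
    (* With [h2], this bounds the pairing by c minus the absolute value of the first coordinate of
       [y]. *)
    have h1 : inner (rsubmx y) (rsubmx x) <= c - lsubmx y 0 0.
      by apply: xP => a /yA1; lra.
    have h2 : inner (rsubmx y) (rsubmx x) <= c + lsubmx y 0 0.
      by apply: xP => a /yA2; lra.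
    nra.
  move=> /convex_hullP xA; split.
    have xb (s : 'rV[R]_1) : s 0 0 = 1 \/ s 0 0 = -1 -> inner (row_mx s 0) x <= 1.
      move=> hs; apply: xA => a; rewrite mem_cat => /orP[] /mapP[a' _ ->];
        rewrite inner_row_mx inner_rV1 (innerC 0) inner0r !mxE eqxx addr0;
        by case: hs => -> /=; lra.
    have := xb 1 (or_introl _); have := xb (-1) (or_intror _).
    rewrite -[x]hsubmxK !inner_row_mx !inner_rV1 !(innerC 0) !inner0r row_mxKl !mxE /= mulr1n.
    by move=> /(_ erefl) ? /(_ erefl) ?; lra.
  rewrite PA; apply/convex_hullP => y c yA.
  have := xA (row_mx 0 y) c; rewrite -{1}[x]hsubmxK inner_row_mx inner_rV1 mxE mul0r add0r.
  apply=> a; rewrite mem_cat => /orP[] /mapP[a' a'A ->];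
    by rewrite inner_row_mx inner_rV1 mxE mul0r add0r yA.
- apply/seteqP; split=> x /=.
    move=> [/andP[xl xr]]; rewrite PB => xP b.
    rewrite -[x]hsubmxK !inE => /or3P[/eqP->|/eqP->|/mapP[b' b'B ->]];
      rewrite inner_row_mx inner_rV1 ?(innerC 0) ?inner0r.
    - by move: xl xr; rewrite !mxE /= mulr1n; lra.
    - by move: xl xr; rewrite !mxE /= mulr1n; lra.
    - by rewrite mxE mul0r add0r; exact: xP.
  move=> xB; split.
    have := xB (row_mx 1 0) (mem_head _ _); have := xB (row_mx (-1) 0) (BN1 _ _).
    rewrite -[x]hsubmxK !inner_row_mx !inner_rV1 !(innerC 0) !inner0r row_mxKl !mxE /=.
    by rewrite mulr1n; lra.
  rewrite PB => b bB; have := xB (row_mx 0 b).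
  rewrite -{1}[x]hsubmxK inner_row_mx inner_rV1 mxE mul0r add0r; apply.
  by rewrite !inE map_f ?orbT.
apply/convex_hullP => y c yB; rewrite inner0r.
have := yB (row_mx 1 0) (mem_head _ _); have := yB (row_mx (-1) 0) (BN1 _ _).
rewrite -[y]hsubmxK !inner_row_mx !inner_rV1 !inner0r !mxE /=.
by rewrite mulr1n; lra.
Qed.

Lemma integer_decomposition_prod_interval d (P : set 'rV[R]_d) N :
  integer_decomposition (prod_interval P) N <-> integer_decomposition P N.
Proof.
split=> hP.
  move=> _ [[p Pp <-] aL].
  have [|b bP ab] := hP (row_mx 0 (N%:R *: p)).
    split; last by apply/lattice_row_mx; split=> //; apply/mxOverP => i j; rewrite mxE.
    exists (row_mx 0 p); last by rewrite scale_row_mx scaler0.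
    by rewrite /prod_interval /= row_mxKl row_mxKr mxE oppr_le0 !ler01.
  exists (fun i => rsubmx (b i)); last first.
    by rewrite -[LHS](row_mxKr (0 : 'rV[R]_1)) ab raddf_sum.
  move=> i; have [[_ ?]] := bP i.
  by rewrite -{1}[b i]hsubmxK => /lattice_row_mx[].
move=> _ [[p [/andP[pl pr] Pp] <-] aL].
move: aL; rewrite -[p]hsubmxK scale_row_mx => /lattice_row_mx[sL aL].
have [|b bP ab] := hP (N%:R *: rsubmx p).
  by split=> //; exists (rsubmx p).
have /mxOverP/(_ 0 0)/intrP[z] := sL; rewrite mxE => zE.
have zN : (`|z| <= N)%N.
  rewrite -lez_nat abszE -(ler_int R) intr_norm -zE normrM normr_nat.
  by rewrite ler_piMr ?ler_norml ?pl.
(* An integer z with |z| <= N is the sum of |z| copies of its sign and N - |z| zeros. *)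
exists (fun i : 'I_N => row_mx (const_mx (sgz z * (i < `|z|)%N%:Z)%:~R) (b i)).
  move=> i; have [bPi bLi] := bP i; split; last first.
    by apply/lattice_row_mx; split=> //; apply/mxOverP => ? ?; rewrite mxE intr_int.
  rewrite /prod_interval /= row_mxKl row_mxKr mxE; split=> //.
  by case: sgzP => _; case: (_ < _)%N; rewrite ?mulr0 ?mul0r ?mulN1r ?mul1r /=; lra.
rewrite ab -[RHS]hsubmxK !raddf_sum; congr row_mx; last first.
  by apply: eq_bigr => i _; rewrite /= row_mxKr.
apply/rowP => j; rewrite summxE (ord1 j) [LHS]mxE zE.
rewrite (eq_bigr (fun i : 'I_N => (sgz z * (i < `|z|)%N%:Z)%:~R)); last first.
  by move=> i _; rewrite /= row_mxKl mxE.
rewrite -raddf_sum -mulr_sumr {1}(intEsg z) abszE; congr (_ * _)%:~R.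
rewrite -[LHS]abszE -{1}[`|z|%N]card_ord -sum1_card.
rewrite (big_ord_widen _ (fun=> 1%N) zN) big_mkcond raddf_sum.
by apply: eq_bigr => i _ /=; case: ifP.
Qed.

End DualPair.

Section Vec4.
Context {D : realDomainType}.

Definition vec4 (x y t z : D) : 'rV[D]_4 := \row_i [:: x; y; t; z]`_i.

Lemma vec4P (a : 'rV[D]_4) : exists x y t z, a = vec4 x y t z.
Proof.
exists (a 0 0), (a 0 1), (a 0 (inord 2)), (a 0 (inord 3)); apply/rowP => i.
rewrite mxE; case: i => -[|[|[|[|//]]]] p /=; congr (a 0 _); apply: val_inj;
  by rewrite /= ?inordK.
Qed.

Lemma vec4D x y t z x' y' t' z' :
  vec4 x y t z + vec4 x' y' t' z' = vec4 (x + x') (y + y') (t + t') (z + z').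
Proof. by apply/rowP => -[[|[|[|[|//]]]] p]; rewrite !mxE. Qed.

Lemma vec4Z k x y t z : k *: vec4 x y t z = vec4 (k * x) (k * y) (k * t) (k * z).
Proof. by apply/rowP => -[[|[|[|[|//]]]] p]; rewrite !mxE. Qed.

Lemma vec4_inj x y t z x' y' t' z' : vec4 x y t z = vec4 x' y' t' z' ->
  [/\ x = x', y = y', t = t' & z = z'].
Proof.
move=> /rowP e.
have := And4 (e (inord 0)) (e (inord 1)) (e (inord 2)) (e (inord 3)).
by rewrite !mxE !inordK.
Qed.

End Vec4.

(** * The polytope P4 by points and by facets *)

Section P4.
Context {R : realType}.

Lemma inner_vec4 (x y t z x' y' t' z' : R) :
  inner (vec4 x y t z) (vec4 x' y' t' z') = x * x' + y * y' + t * t' + z * z'.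
Proof. by rewrite /inner !big_ord_recl big_ord0 !mxE /= addr0 !addrA. Qed.

Lemma lattice_vec4 (x y t z : R) : lattice (vec4 x y t z) <->
  exists a b c e : int, [/\ x = a%:~R, y = b%:~R, t = c%:~R & z = e%:~R].
Proof.
split=> [/mxOverP h|[a [b [c [e [-> -> -> ->]]]]]].
  have hi (i : 'I_4) : [:: x; y; t; z]`_i \is a Num.int by have := h 0 i; rewrite mxE.
  have /intrP[a xE] := hi (inord 0); have /intrP[b yE] := hi (inord 1).
  have /intrP[c tE] := hi (inord 2); have /intrP[e zE] := hi (inord 3).
  by exists a, b, c, e; move: xE yE tE zE; rewrite !inordK.
by apply/mxOverP => i [[|[|[|[|//]]]] p]; rewrite mxE /= intr_int.
Qed.

Definition points4 : seq 'rV[R]_4 :=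
  [:: vec4 0 0 0 1; vec4 0 0 1 1; vec4 1 0 0 1; vec4 1 0 1 1;
      vec4 0 1 0 1; vec4 0 1 1 1; vec4 1 1 4 1; vec4 1 1 5 1;
      vec4 (-1) (-1) (-3) (-2); vec4 0 0 1 0; vec4 0 0 (-1) 0; vec4 0 0 0 0].

(** After the base come the functionals z - 3 s / s(-v), with s a slack of the cone over E4: they
    are 1 at v and on the ridge s = 0, z = 1. *)
Definition facets4 : seq 'rV[R]_4 :=
  [:: vec4 0 0 0 1; vec4 (-3) 0 0 1; vec4 0 (-3) 0 1; vec4 3 0 0 (-2);
      vec4 0 3 0 (-2); vec4 0 0 (-1) 1; vec4 4 4 (-1) (-3);
      vec4 (-4) 0 1 0; vec4 0 (-4) 1 0].

Definition P4 : set 'rV[R]_4 := [set x | forall b, b \in facets4 -> inner b x <= 1].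

Lemma P4E (x y t z : R) : P4 (vec4 x y t z) <-> facet_ineqs 1 x y t z.
Proof.
split=> [h|[[? ? ? ?] [? ? ?] ? ?] b].
  have hi i : (i < 9)%N -> inner facets4`_i (vec4 x y t z) <= 1.
    by move=> i9; apply/h/mem_nth.
  have := And4 (hi 0 isT) (hi 1 isT) (hi 2 isT) (hi 3 isT).
  have := And5 (hi 4 isT) (hi 5 isT) (hi 6 isT) (hi 7 isT) (hi 8 isT).
  rewrite /= !inner_vec4 => -[? ? ? ? ?] [? ? ? ?].
  by split; [split| split | |]; lra.
by rewrite !inE; do 8?[case/predU1P => [->|]]; last move/eqP->; rewrite inner_vec4; lra.
Qed.

Lemma points4_P4 a : a \in points4 -> P4 a.
Proof.
rewrite !inE; do 11?[case/predU1P => [->|]]; last move/eqP->;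
  by apply/P4E; split; [split|split| |]; lra.
Qed.

Lemma points4_lattice a : a \in points4 -> lattice a.
Proof.
rewrite !inE; do 11?[case/predU1P => [->|]]; last move/eqP->;
  by apply/mxOverP => i [[|[|[|[|//]]]] p]; rewrite mxE /= ?rpredN ?rpred0 ?rpred1 ?natr_int.
Qed.

Lemma facets4_lattice b : b \in facets4 -> lattice b.
Proof.
rewrite !inE; do 8?[case/predU1P => [->|]]; last move/eqP->;
  by apply/mxOverP => i [[|[|[|[|//]]]] p]; rewrite mxE /= ?rpredN ?rpred0 ?rpred1 ?natr_int.
Qed.

Lemma P4_hull : P4 = convex_hull [set` points4].
Proof.
apply/seteqP; split=> a; have [x [y [t [z ->]]]] := vec4P a.
  have thirds : @has_thirds R.
    by move=> s s0; exists (s / 3), 0; split=> //; [lra..|move=> u; lra].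
  move/P4E => xP.
  have : weighted_sum 1 x y t z.
    have [//|[[x0 xz y0 yz] t0 txy tx ty]] := facet_ineqs_cover thirds xP.
    (* Over the reals the largest of the three lower bounds serves as i, so there is no hole. *)
    have [i [i0 ixy it [ix iy it']]] : exists i : R,
        [/\ 0 <= i, x + y - z <= i, (t - z) / 4 <= i & [/\ i <= x, i <= y & 4 * i <= t]].
      have [h1|h1] := leP 0 (x + y - z); have [h2|h2] := leP (x + y - z) ((t - z) / 4);
        have [h3|h3] := leP 0 ((t - z) / 4);
        first [by exists ((t - z) / 4); split; [lra..|split; lra]
              |by exists (x + y - z); split; [lra..|split; lra]
              |by exists 0; split; [lra..|split; lra]].
    have [[zn _ _ _] _ _ _] := xP.
    by apply: (@cone_E4_weighted_sum _ 1 x y t z i); lra.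
  move=> [b0 [t0 [b1 [t1 [b2 [t2 [b3 [t3 [v [e [w [u]]]]]]]]]]]].
  move=> [[? ? ? ?] [? ? ? ?] [? ? ? ?] nE [xE yE tE zE]].
  exists 12%N, (fun i => points4`_i),
    (fun i => [:: b0; t0; b1; t1; b2; t2; b3; t3; v; e; w; u]`_i); split.
  - by move=> i; apply: mem_nth.
  - by case; do 12?[case=> //].
  - by rewrite !big_ord_recl big_ord0 /= nE; ring.
  - rewrite !big_ord_recl big_ord0 /= addr0 !vec4Z !vec4D xE yE tE zE.
    by congr vec4; ring.
move=> /convex_hullP xA b bB; apply: xA => a' a'A; exact: (points4_P4 a'A).
Qed.

Lemma dual_pair_P4 : dual_pair P4 points4 facets4.
Proof.
split; [exact: points4_lattice|exact: facets4_lattice|exact: P4_hull|by []|].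
apply/convex_hullP => y c; have [y1 [y2 [y3 [y4 ->]]]] := vec4P y => yB.
have hi i : (i < 9)%N -> inner (vec4 y1 y2 y3 y4) facets4`_i <= c.
  by move=> i9; apply/yB/mem_nth.
have := And4 (hi 0%N isT) (hi 1%N isT) (hi 2%N isT) (hi 3%N isT).
have := And5 (hi 4%N isT) (hi 5%N isT) (hi 6%N isT) (hi 7%N isT) (hi 8%N isT).
(* The first, second and fourth normals sum to 0, so 0 is their mean. *)
by rewrite /= !inner_vec4 inner0r => -[? ? ? ? ?] [? ? ? ?]; lra.
Qed.

End P4.

(** Repeating each element by its multiplicity turns natural weights into the [N] summands that
    [integer_decomposition] asks for. *)
Lemma sum_of_multiplicities (V : nmodType) (A : seq V) (m : nat -> nat) N :
  (\sum_(i < size A) m i)%N = N ->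
  exists2 b : 'I_N -> V, forall i, b i \in A
    & \sum_(i < N) b i = \sum_(i < size A) A`_i *+ m i.
Proof.
move=> <-.
pose s := flatten [seq nseq (m i) A`_i | i : 'I_(size A)].
have sN : size s = (\sum_(i < size A) m i)%N.
  rewrite size_flatten sumnE /shape big_map big_image.
  by apply: eq_bigr => i _; rewrite size_nseq.
rewrite -sN; exists (fun i => s`_i).
  move=> i; have : s`_i \in s by exact: mem_nth.
  move=> /flattenP[r /mapP[j _ ->]]; rewrite mem_nseq => /andP[_ /eqP->].
  exact: mem_nth.
rewrite -(big_mkord xpredT (fun i => s`_i)) -(big_nth 0 xpredT id) /=.
rewrite big_flatten big_image; apply: eq_bigr => i _.
by rewrite big_nseq iter_addr_0.
Qed.

(** * Lattice points of the dilates of P4 *)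

Section P4_lattice_points.
Context {R : realType}.

Lemma facet_ineqs_scale (k n x y t z : R) : 0 <= k -> facet_ineqs n x y t z ->
  facet_ineqs (k * n) (k * x) (k * y) (k * t) (k * z).
Proof.
move=> k0 [[? ? ? ?] [? ? ?] ? ?].
by split; [split|split| |]; nra.
Qed.

Lemma facet_ineqs_int (n x y t z : int) :
  facet_ineqs (n%:~R : R) x%:~R y%:~R t%:~R z%:~R -> facet_ineqs n x y t z.
Proof.
move=> [[? ? ? ?] [? ? ?] ? ?].
by split; [split|split| |]; rewrite -(ler_int R) ?(rmorphB, rmorphM, rmorphD)/=.
Qed.

Lemma dilate_P4_lattice N a : (dilate N (@P4 R) `&` lattice) a ->
  exists x y t z : int, a = vec4 x%:~R y%:~R t%:~R z%:~R /\
    facet_ineqs N%:Z x y t z.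
Proof.
move=> [[p + <-]]; have [x [y [t [z ->]]]] := vec4P p; move=> /P4E pP.
rewrite vec4Z => /lattice_vec4[x' [y' [t' [z' [xE yE tE zE]]]]].
exists x', y', t', z'; rewrite -xE -yE -tE -zE; split=> //.
apply: facet_ineqs_int; rewrite -xE -yE -tE -zE -[N%:Z%:~R]mulr1.
exact: facet_ineqs_scale.
Qed.

Lemma weighted_sum_int N (x y t z : int) : (3 <= N)%N ->
  facet_ineqs N%:Z x y t z -> weighted_sum N%:Z x y t z.
Proof.
move=> N3 xP.
have thirds : @has_thirds int.
  move=> s s0; exists (s %/ 3)%Z, (s %% 3)%Z.
  by split=> [| | |u]; lia.
have [//|[[x0 xz y0 yz] t0 txy tx ty]] := facet_ineqs_cover thirds xP.
have [[zn _ _ _] _ _ _] := xP.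
have [/and4P[/eqP-> /eqP-> /eqP-> /eqP->]|h] :=
    boolP [&& x == 1, y == 1, t == 3 & z == 2].
  (* The hole is (1, 0, 1, 1) + (0, 1, 1, 1) + (0, 0, 1, 0), filled up with N - 3 zeros. *)
  by exists 0, 0, 0, 1, 0, 1, 0, 0, 0, 1, 0, (N%:Z - 3); split; [split; lia..|lia|split; lia].
have [i [i0 ixy [ix iy it it']]] : exists i : int,
    [/\ 0 <= i, x + y - z <= i & [/\ i <= x, i <= y, 4 * i <= t & t <= 4 * i + z]].
  (* Take i as large as possible. When i is t / 4 rounded down, t <= 4 i + z fails only at the hole,
     where the remainder 3 of t exceeds z = 2. *)
  have [xt|tx'] := leP (4 * Num.min x y) t.
    by exists (Num.min x y); split; [lia..|split; lia].
  exists (t %/ 4)%Z; split; [lia..|split; lia].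
exact: (@cone_E4_weighted_sum _ N%:Z x y t z i).
Qed.

Lemma integer_decomposition_P4 N : (3 <= N)%N -> integer_decomposition (@P4 R) N.
Proof.
move=> N3 a /dilate_P4_lattice[x [y [t [z [-> /(weighted_sum_int N3)]]]]].
move=> [b0 [t0 [b1 [t1 [b2 [t2 [b3 [t3 [v [e [w [u]]]]]]]]]]]].
move=> [[b00 t00 b10 t10] [b20 t20 b30 t30] [v0 e0 w0 u0] nE [-> -> -> ->]].
move: b0 b00 t0 t00 b1 b10 t1 t10 b2 b20 t2 t20 b3 b30 t3 t30 v v0 e e0 w w0 u u0 nE.
move=> [b0|//] _ [t0|//] _ [b1|//] _ [t1|//] _ [b2|//] _ [t2|//] _.
move=> [b3|//] _ [t3|//] _ [v|//] _ [e|//] _ [w|//] _ [u|//] _ nE.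
pose m i := nth 0%N [:: b0; t0; b1; t1; b2; t2; b3; t3; v; e; w; u] i.
have [|c cA cE] := @sum_of_multiplicities 'rV[R]_4 points4 m N.
  by rewrite !big_ord_recl big_ord0 /m /=; lia.
exists c; first by move=> i; split; [exact: points4_P4|exact: points4_lattice].
rewrite cE; under eq_bigr => i _ do rewrite -scaler_nat.
rewrite !big_ord_recl big_ord0 /m /= addr0 !vec4Z !vec4D.
by congr vec4; rewrite ?(rmorphB, rmorphD, rmorphM, rmorph_nat) /=; ring.
Qed.

Lemma not_integer_decomposition_P4 : ~ integer_decomposition (@P4 R) 2.
Proof.
move=> P2; have [|b bP] := P2 (vec4 1 1 3 2).
  split; last by apply/lattice_vec4; exists 1, 1, 3, 2.
  exists (vec4 (1 / 2) (1 / 2) (3 / 2) 1).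
    by apply/P4E; split; [split|split| |]; lra.
  by rewrite vec4Z; congr vec4; lra.
have bE i : exists x y t z : int, b i = vec4 x%:~R y%:~R t%:~R z%:~R /\
    facet_ineqs 1 x y t z.
  apply: (@dilate_P4_lattice 1); case: (bP i) => Pb Lb; split=> //.
  by exists (b i) => //; rewrite scale1r.
rewrite !big_ord_recl big_ord0 addr0.
have [x [y [t [z [-> [[? ? ? ?] [? ? ?] ? ?]]]]]] := bE ord0.
have [x' [y' [t' [z' [-> [[? ? ? ?] [? ? ?] ? ?]]]]]] := bE (lift ord0 ord0).
rewrite vec4D -!rmorphD => /vec4_inj[xE yE tE zE].
have {xE yE tE zE} [xE yE tE zE] :
    [/\ 1 = x + x', 1 = y + y', 3 = t + t' & 2 = z + z'].
  by split; apply: (@intr_inj R).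
(* As z and z' are at most 1, both are 1; the summands then lie over opposite corners of the square,
   and their heights add up to 0..2 or 4..6. *)
by lia.
Qed.

End P4_lattice_points.

Theorem corollary1p2 (R : realType) (d : nat) (hd : (4 <= d)%N) :
  exists P : set 'rV[R]_d,
    [/\ reflexive_polytope P, has_dimension P d, very_ample P
      & ~ normal_polytope P].
Proof.
(* All three properties pass to the product with an interval, which allows induction on [d]. *)
have [P [A [B [PAB PN P2]]]] : exists (P : set 'rV[R]_d) A B,
    [/\ dual_pair P A B, forall N, (3 <= N)%N -> integer_decomposition P N
      & ~ integer_decomposition P 2].
  elim: d hd => // d IH; rewrite leq_eqVlt => /predU1P[<-|/IH[P [A [B [PAB PN P2]]]]].
    exists P4, points4, facets4; split; first exact: dual_pair_P4.
      exact: integer_decomposition_P4.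
    exact: not_integer_decomposition_P4.
  have [A' [B' PAB']] : exists A' B', dual_pair (prod_interval P) A' B'.
    by do 2!eexists; exact: dual_pair_prod_interval PAB.
  exists (prod_interval P), A', B'; split=> // [N N3|].
    exact/integer_decomposition_prod_interval/PN.
  by move/integer_decomposition_prod_interval.
have [Plat Pdim ? ?] := dual_pair_reflexive PAB.
exists P; split=> //; last by move=> [_ /(_ 2%N isT)].
by split=> //; exists 3%N => N _; exact: PN.
Qed.
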